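(* Let $n\ge 4$. The intrinsic torus of $\mathcal{M}_{0,n}$ is canonically isomorphic to the torus $T_U=\operatorname{Spec}\mathbb{C}[u_{ij}^{\pm1} \mid (i,j)\in \mathrm{diag}_n]$. Equivalently, the character lattice $\Lambda=\mathbb{C}[\mathcal{M}_{0,n}]^\times/\mathbb{C}^\times$ is identified with the lattice of Laurent monomials $\{\prod_{(i,j)\in\mathrm{diag}_n} u_{ij}^{X_{ij}} \mid X_{ij}\in\mathbb{Z}\}$ in the dihedral coordinates; that is, the classes of the dihedral coordinates $u_{ij}$, $(i,j)\in\mathrm{diag}_n$, form a $\mathbb{Z}$-basis of $\Lambda$.
   Context: $\mathcal{M}_{0,n}$ is the moduli space (over $\mathbb{C}$) of $n$ distinct points $\sigma_1,\dots,\sigma_n$ on $\mathbb{P}^1$ modulo the simultaneous action of $\mathrm{PGL}(2)$; it is a smooth affine variety of dimension $n-3$. Let $\mathrm{diag}_n$ be the set of diagonals of an $n$-gon with vertices $1,\dots,n$ in cyclic order, i.e. unordered pairs $(i,j)$ of vertices that are neither equal nor adjacent modulo $n$; $|\mathrm{diag}_n|=\binom n2-n$. The dihedral coordinates are the regular nowhere-vanishing functions on $\mathcal{M}_{0,n}$ $$u_{ij}=\frac{(\sigma_i-\sigma_{j+1})(\sigma_{i+1}-\sigma_j)}{(\sigma_i-\sigma_j)(\sigma_{i+1}-\sigma_{j+1})},\qquad (i,j)\in\mathrm{diag}_n,$$ with indices modulo $n$. They define a map $\mathcal{M}_{0,n}\to T_U$, where $T_U$ is the $(\binom n2-n)$-dimensional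 torus with coordinates $u_{ij}$. The group $\Lambda=\mathbb{C}[\mathcal{M}_{0,n}]^\times/\mathbb{C}^\times$ of units of the coordinate ring modulo scalars is a free abelian group; the intrinsic torus of $\mathcal{M}_{0,n}$ is the torus with character lattice $\Lambda$. *)

(* Defs.v *)
From HB Require Import structures.
From mathcomp Require Import all_boot all_order all_algebra.
From mathcomp Require Import generic_quotient ring_quotient.
From mathcomp Require Import boolp classical_sets functions reals.
From mathcomp Require Import complex mpoly ring.

Set Implicit Arguments.
Unset Strict Implicit.
Unset Printing Implicit Defensive.

Import Order.TTheory GRing.Theory Num.Theory.
Local Open Scope ring_scope.
Local Open Scope quotient_scope.

(* The unit group of a commutative ring, with its group law written           *)
(* additively so that it can be used as a Z-module: u + v is the product,     *)
(* - u the inverse, and u *~ m the m-th power.                                *)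
Section UnitGroup.
Variable A : comUnitRingType.

Record units := Units { uval : A; uvalP : uval \is a GRing.unit }.

HB.instance Definition _ := [isSub for uval].
HB.instance Definition _ := [Choice of units by <:].

Definition units_one := Units (@unitr1 A).
Definition units_inv (u : units) := Units (etrans (unitrV (uval u)) (uvalP u)).
Definition units_mul (u v : units) :=
  Units (etrans (unitrMl (uval u) (uvalP v)) (uvalP u)).

Fact units_mulA : associative units_mul.
Proof. by move=> u v w; apply: val_inj; rewrite /= mulrA. Qed.
Fact units_mulC : commutative units_mul.
Proof. by move=> u v; apply: val_inj; rewrite /= mulrC. Qed.
Fact units_mul1 : left_id units_one units_mul.
Proof. by move=> u; apply: val_inj; rewrite /= mul1r. Qed.
Fact units_mulV : left_inverse units_one units_inv units_mul.
Proof. by move=> u; apply: val_inj; rewrite /= mulVr ?uvalP. Qed.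

HB.instance Definition _ :=
  GRing.isZmodule.Build units units_mulA units_mulC units_mul1 units_mulV.

Lemma uval0 : uval 0 = 1. Proof. by []. Qed.
Lemma uvalD u v : uval (u + v) = uval u * uval v. Proof. by []. Qed.
Lemma uvalN u : uval (- u) = (uval u)^-1. Proof. by []. Qed.

End UnitGroup.

Section UnitsMap.
Variables (A B : comUnitRingType) (h : {rmorphism A -> B}).

Definition units_map (u : units A) : units B :=
  Units (rmorph_unit h (uvalP u)).

Fact units_map_additive : zmod_morphism units_map.
Proof.
by move=> u v; apply: val_inj; rewrite /= rmorphM /= rmorphV ?uvalP.
Qed.

HB.instance Definition _ :=
  GRing.isZmodMorphism.Build (units A) (units B) units_map units_map_additive.

End UnitsMap.

Section CharacterLattice.
Variables (K : fieldType) (A : comUnitAlgType K).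

Definition scalar_units : {pred units A} :=
  [pred u : units A | `[< exists c : K, uval u = c%:A >] ].

Fact scalar_units_closed : zmod_closed scalar_units.
Proof.
split=> [|u v]; first by apply/asboolP; exists 1; rewrite scale1r.
move=> /asboolP[c uc] /asboolP[d vd]; apply/asboolP; exists (c / d).
have d0 : d != 0.
  by apply: contraTneq (uvalP v) => d0; rewrite vd d0 scale0r unitr0.
rewrite uvalD uvalN uc vd invrZ ?unitfE ?unitr1 // invr1.
by rewrite -scalerAl mul1r scalerA.
Qed.

HB.instance Definition _ :=
  GRing.isZmodClosed.Build (units A) scalar_units scalar_units_closed.

(* A^* / K^*, again in additive notation. *)
Definition char_lattice := Quotient.quot scalar_units.
HB.instance Definition _ := GRing.Zmodule.on char_lattice.

Definition unit_class (u : units A) : char_lattice := \pi_char_lattice u.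

End CharacterLattice.

Definition is_Zbasis (L : zmodType) (I : finType) (e : I -> L) : Prop :=
  forall x : L, exists! X : {ffun I -> int}, x = \sum_i e i *~ X i.

(* Tori are given by their functors of points on commutative K-algebras B:    *)
(* the torus with character lattice L is Spec K[L], whose B-points are the    *)
(* group morphisms L -> B^*, and a B-point of Spec K[t_i^{+-1} | i : I] is a  *)
(* family of units of B indexed by I. Every nonzero commutative K-algebra is  *)
(* classically a comUnitAlgType, and over the zero algebra both functors have *)
(* a single point.                                                            *)
Section Tori.
Variables (K : fieldType).

Definition char_torus (L : zmodType) (B : comUnitAlgType K) :=
  {additive L -> units B}.

Definition coord_torus (I : finType) (B : comUnitAlgType K) :=
  {ffun I -> units B}.

(* phi is an isomorphism of K-group schemes Spec K[L] -> Spec K[t_i^{+-1}]:   *)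
(* bijective on B-points, multiplicative, and natural in B.                   *)
Record torus_iso (L : zmodType) (I : finType)
    (phi : forall B : comUnitAlgType K, char_torus L B -> coord_torus I B) :
    Prop := TorusIso {
  torus_iso_bij : forall B, bijective (phi B);
  torus_iso_mul : forall B (x y : char_torus L B),
    phi B (x \+ y) = phi B x + phi B y;
  torus_iso_nat : forall (B B' : comUnitAlgType K) (h : {lrmorphism B -> B'})
    (x : char_torus L B),
    phi B' (units_map h \o x) = [ffun i => units_map h (phi B x i)]
}.

(* The morphism Spec K[L] -> Spec K[t_i^{+-1}] pulling t_i back to e i. *)
Definition torus_eval (L : zmodType) (I : finType) (e : I -> L)
    (B : comUnitAlgType K) (x : char_torus L B) : coord_torus I B :=
  [ffun i => x (e i)].

End Tori.

Section Moduli.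
Variables (K : numFieldType) (n : nat).

(* A point of P^1(K) is a line of K^2. *)
Record P1 := MkP1 { line : {vspace 'rV[K]_2}; lineP : \dim line == 1%N }.
HB.instance Definition _ := [isSub for line].
HB.instance Definition _ := [Choice of P1 by <:].

Record config := MkConfig {
  pts : {ffun 'I_n -> P1};
  ptsP : injectiveb pts
}.
HB.instance Definition _ := [isSub for pts].
HB.instance Definition _ := [Choice of config by <:].

Definition gl_act (g : 'M[K]_2) (l : {vspace 'rV[K]_2}) : {vspace 'rV[K]_2} :=
  (linfun (mulmxr g : 'rV[K]_2 -> 'rV[K]_2) @: l)%VS.

Definition pgl_equiv (s t : config) : bool :=
  `[< exists2 g : 'M[K]_2, g \in unitmx &
        forall i, line (pts t i) = gl_act g (line (pts s i)) >].

Lemma gl_act1 l : gl_act 1%:M l = l.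
Proof.
rewrite /gl_act -[RHS]lim1g; congr (_ @: _)%VS.
by apply/lfunP => v; rewrite lfunE /= mulmx1 lfunE.
Qed.

Lemma gl_actM g h l : gl_act h (gl_act g l) = gl_act (g *m h) l.
Proof.
rewrite /gl_act -limg_comp; congr (_ @: _)%VS.
by apply/lfunP => v; rewrite comp_lfunE !lfunE /= mulmxA.
Qed.

Fact pgl_equiv_is_equiv : equiv_class_of pgl_equiv.
Proof.
have sym s t : pgl_equiv s t -> pgl_equiv t s.
  move=> /asboolP[g gu e]; apply/asboolP; exists (invmx g).
    by rewrite unitmx_inv.
  by move=> i; rewrite e gl_actM mulmxV // gl_act1.
split=> [s|s t|t s r].
- by apply/asboolP; exists 1%:M; rewrite ?unitmx1 // => i; rewrite gl_act1.
- by apply/idP/idP; apply: sym.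
- move=> /asboolP[g gu e] /asboolP[h hu f]; apply/asboolP; exists (g *m h).
    by rewrite unitmx_mul gu.
  by move=> i; rewrite f e gl_actM.
Qed.

Canonical pgl_equiv_equiv := EquivRelPack pgl_equiv_is_equiv.

(* The K-points of M_{0,n}. *)
Definition M0 := {eq_quot pgl_equiv}.
HB.instance Definition _ := Choice.on M0.
HB.instance Definition _ := EqQuotient.on M0.

(* The rows of M are homogeneous coordinates of the points of s. *)
Definition homog_coords (M : 'M[K]_(n, 2)) (s : config) : Prop :=
  forall i, line (pts s i) = <[row i M]>%VS.

(* bracket M i j = x_i y_j - y_i x_j is y_i y_j (sigma_i - sigma_j) for       *)
(* sigma = x / y.                                                             *)
Definition bracket (M : 'M[K]_(n, 2)) (i j : 'I_n) : K :=
  M i 0 * M j 1 - M i 1 * M j 0.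

Definition disc (M : 'M[K]_(n, 2)) : K :=
  \prod_(i < n) \prod_(j < n | (i < j)%N) bracket M i j.

(* Regular functions on M_{0,n} are the PGL(2)-invariant regular functions on *)
(* the space of configurations, which itself is the quotient of the affine    *)
(* variety disc != 0 by the rescaling of homogeneous coordinates. As K is     *)
(* infinite and this variety is open in affine space, its functions           *)
(* are determined by their values at K-points.                                *)
Definition regular_fun : {pred M0 -> K} := fun f =>
  `[< exists (P : {mpoly K[n * 2]}) (k : nat), forall s M, homog_coords M s ->
        f (\pi_M0 s) = P.@[fun i => mxvec M 0 i] / disc M ^+ k >].

Definition std_coords (s : config) : 'M[K]_(n, 2) :=
  \matrix_i vpick (line (pts s i)).

Lemma std_coordsP s : homog_coords (std_coords s) s.
Proof.
move=> i; rewrite rowK.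
have d1 := eqP (lineP (pts s i)); apply/esym/eqP.
rewrite eqEdim -memvE memv_pick d1 dim_vline lt0n eqb0 negbK.
by rewrite vpick0 -dimv_eq0 d1.
Qed.

Lemma bracket_neq0 s M i j : homog_coords M s -> i != j -> bracket M i j != 0.
Proof.
move=> Ms; apply: contraNneq => b0; apply/eqP.
apply: (injectiveP _ (ptsP s)); apply: val_inj; rewrite /= !Ms.
have rn0 k : row k M != 0.
  apply/eqP => r0; have := lineP (pts s k).
  by rewrite Ms r0 dim_vline eqxx.
suff le k l : bracket M k l = 0 -> (<[row k M]> <= <[row l M]>)%VS.
  apply/eqP; rewrite eqEsubv !le //.
  by rewrite -oppr0 -b0 /bracket; ring.
move=> kl0; rewrite -memvE; apply/vlineP.
have e : M k 0 * M l 1 = M k 1 * M l 0 by apply/eqP; rewrite -subr_eq0 -kl0.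
have ordP (c : 'I_2) : c = 0 \/ c = 1.
  by case: c => [[|[|//]] p]; [left|right]; apply: val_inj.
have [l0|l0] := eqVneq (M l 0) 0.
  have l1 : M l 1 != 0.
    apply: contraNneq (rn0 l) => l1; apply/eqP/rowP => c; rewrite !mxE.
    by case: (ordP c) => ->.
  exists (M k 1 / M l 1); apply/rowP=> c; rewrite !mxE.
  case: (ordP c) => ->; rewrite ?divfK // l0 mulr0.
  by apply: (mulIf l1); rewrite e l0 mulr0 mul0r.
exists (M k 0 / M l 0); apply/rowP=> c; rewrite !mxE.
case: (ordP c) => ->; rewrite ?divfK //.
by apply: (mulIf l0); rewrite mulrAC divfK // e.
Qed.

Lemma disc_neq0 s M : homog_coords M s -> disc M != 0.
Proof.
move=> Ms; apply/prodf_neq0 => i _; apply/prodf_neq0 => j ij.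
by apply: (bracket_neq0 Ms); apply: contraTneq ij => ->; rewrite ltnn.
Qed.

(* F restricts to a regular function on the affine variety disc != 0. *)
Definition crep (F : 'M[K]_(n, 2) -> K) : Prop :=
  exists (P : {mpoly K[n * 2]}) (k : nat), forall s M, homog_coords M s ->
    F M = P.@[fun i => mxvec M 0 i] / disc M ^+ k.

Lemma regularP f F : (forall s M, homog_coords M s -> f (\pi_M0 s) = F M) ->
  crep F -> regular_fun f.
Proof.
move=> fF [P [k H]]; apply/asboolP; exists P, k => s M Ms.
by rewrite (fF s M) // (H s).
Qed.

Lemma crepC c : crep (fun=> c).
Proof. by exists c%:MP, 0%N => s M _; rewrite mevalC expr0 divr1. Qed.

Lemma crep_entry i c : crep (fun M => M i c).
Proof.
exists 'X_(mxvec_index i c), 0%N => s M _.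
by rewrite mevalXU mxvecE expr0 divr1.
Qed.

Lemma crepM F G : crep F -> crep G -> crep (fun M => F M * G M).
Proof.
move=> [P [k HP]] [Q [l HQ]]; exists (P * Q), (k + l)%N => s M Ms.
by rewrite (HP s) // (HQ s) // mevalM exprD invfM mulrACA.
Qed.

Definition disc_mpoly : {mpoly K[n * 2]} :=
  \prod_(i < n) \prod_(j < n | (i < j)%N)
    ('X_(mxvec_index i 0) * 'X_(mxvec_index j 1) -
     'X_(mxvec_index i 1) * 'X_(mxvec_index j 0)).

Lemma disc_mpolyE M : disc_mpoly.@[fun i => mxvec M 0 i] = disc M.
Proof.
rewrite /disc_mpoly rmorph_prod; apply: eq_bigr => i _ /=.
rewrite rmorph_prod; apply: eq_bigr => j _ /=.
by rewrite mevalB !mevalM !mevalXU !mxvecE.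
Qed.

Lemma crepD F G : crep F -> crep G -> crep (fun M => F M + G M).
Proof.
move=> [P [k HP]] [Q [l HQ]].
exists (P * disc_mpoly ^+ l + Q * disc_mpoly ^+ k), (k + l)%N => s M Ms.
rewrite (HP s) // (HQ s) // mevalD !mevalM !rmorphXn /= disc_mpolyE exprD.
have dk : disc M ^+ k != 0 by rewrite expf_neq0 // (disc_neq0 Ms).
have dl : disc M ^+ l != 0 by rewrite expf_neq0 // (disc_neq0 Ms).
by field; rewrite dk dl.
Qed.

Lemma crep_prod I (r : seq I) (p : pred I) (F : I -> 'M[K]_(n, 2) -> K) :
  (forall i, p i -> crep (F i)) -> crep (fun M => \prod_(i <- r | p i) F i M).
Proof.
move=> H; elim: r => [|i r IH].
  under eq_fun do rewrite big_nil; exact: crepC.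
under eq_fun do rewrite big_cons; case pi: (p i) => //.
by apply: crepM IH; apply: H.
Qed.

Lemma crepN F : crep F -> crep (fun M => - F M).
Proof.
by move=> [P [k H]]; exists (- P), k => s M Ms; rewrite (H s) // mevalN mulNr.
Qed.

Lemma crep_bracket i j : crep (fun M => bracket M i j).
Proof.
exact: crepD (crepM (crep_entry i 0) (crep_entry j 1))
  (crepN (crepM (crep_entry i 1) (crep_entry j 0))).
Qed.

Lemma crep_bracketV i j : i != j -> crep (fun M => (bracket M i j)^-1).
Proof.
wlog ij : i j / (i < j)%N.
  move=> W; case: (ltngtP i j) => [||/val_inj->]; rewrite ?eqxx //.
    exact: W.
  move=> ji ne; have [P [k H]] := W _ _ ji (contra_neq esym ne).
  exists (- P), k => s M Ms; rewrite mevalN mulNr -(H s) // -invrN.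
  by congr (_^-1); rewrite /bracket; ring.
move=> ne.
have [P [k H]] : crep (fun M =>
    (\prod_(a < n | a != i) \prod_(b < n | (a < b)%N) bracket M a b) *
    (\prod_(b < n | (i < b)%N && (b != j)) bracket M i b)).
  apply: crepM; last by apply: crep_prod => *; exact: crep_bracket.
  by do 2!apply: crep_prod => *; exact: crep_bracket.
exists P, k.+1 => s M Ms; rewrite exprSr invfM mulrA -(H s) //.
have := disc_neq0 Ms; rewrite /disc (bigD1 i) //= (bigD1 j) //=.
set x := bracket M i j; set y := \prod_(_ < n | _) _; set z := \prod_(_ < n | _) _.
rewrite !mulf_eq0 !negb_or -andbA => /and3P[x0 y0 z0].
by field; rewrite x0 y0 z0.
Qed.


Let affine_vec (i : 'I_n) : 'rV[K]_2 :=
  \row_(c < 2) (if c == 0 then i%:R else 1).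

Fact point_line_subproof i : \dim <[affine_vec i]>%VS == 1%N.
Proof.
rewrite dim_vline eqb1; apply/eqP => /rowP/(_ 1); rewrite !mxE /=.
by move/eqP; rewrite oner_eq0.
Qed.

Fact config0_subproof :
  injectiveb [ffun i => MkP1 (point_line_subproof i)].
Proof.
apply/injectiveP => i j; rewrite !ffunE => /(congr1 line) /= /eqP.
rewrite eqEsubv => /andP[+ _]; rewrite -memvE => /vlineP[a /rowP e].
have := e 1; rewrite !mxE /= mulr1 => a1.
have := e 0; rewrite !mxE /= -a1 mul1r => /eqP; rewrite eqr_nat => /eqP.
exact: val_inj.
Qed.

HB.instance Definition _ :=
  isPointed.Build M0 (\pi_M0 (MkConfig config0_subproof)).

Fact regular_subring : subring_closed regular_fun.
Proof.
have rF f : regular_fun f -> exists2 F,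
    (forall s M, homog_coords M s -> f (\pi_M0 s) = F M) & crep F.
  move=> /asboolP[P [k H]].
  by exists (fun M => P.@[fun i => mxvec M 0 i] / disc M ^+ k); last exists P, k.
split=> [|f g /rF[F fF cF] /rF[G gG cG]|f g /rF[F fF cF] /rF[G gG cG]].
- by apply: (@regularP _ (fun=> 1)); [|exact: crepC].
- apply: (@regularP _ (fun M => F M - G M)); last exact: crepD (crepN cG).
  by move=> s M Ms; rewrite -(fF s) // -(gG s).
- apply: (@regularP _ (fun M => F M * G M)); last exact: crepM.
  by move=> s M Ms; rewrite -(fF s) // -(gG s).
Qed.

HB.instance Definition _ :=
  GRing.isSubringClosed.Build (M0 -> K) regular_fun regular_subring.

(* The coordinate ring of M_{0,n}. *)
Record coordRing := MkCoord { cfun :> M0 -> K; cfun_regular : cfun \in regular_fun }.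
HB.instance Definition _ := [isSub for cfun].
HB.instance Definition _ := [Choice of coordRing by <:].
HB.instance Definition _ := [SubChoice_isSubComNzRing of coordRing by <:].


Fact scale_regular (c : K) (f : coordRing) :
  (fun x => c * f x) \in regular_fun.
Proof.
have /asboolP[P [k H]] := cfun_regular f; apply/asboolP.
by exists (c *: P), k => s M Ms; rewrite mevalZ -mulrA -(H s).
Qed.

Definition coord_scale c f : coordRing := MkCoord (scale_regular c f).

Fact coord_scaleA a b f : coord_scale a (coord_scale b f) = coord_scale (a * b) f.
Proof. by apply/val_inj/funext => x /=; exact: mulrA. Qed.
Fact coord_scale1 : left_id 1 coord_scale.
Proof. by move=> f; apply/val_inj/funext => x /=; exact: mul1r. Qed.
Fact coord_scaleDr : right_distributive coord_scale +%R.
Proof. by move=> c f g; apply/val_inj/funext => x /=; exact: mulrDr. Qed.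
Fact coord_scaleDl f : {morph coord_scale^~ f : a b / a + b}.
Proof. by move=> a b; apply/val_inj/funext => x /=; exact: mulrDl. Qed.

HB.instance Definition _ := GRing.Zmodule_isLmodule.Build K coordRing
  coord_scaleA coord_scale1 coord_scaleDr coord_scaleDl.

Fact coord_scaleAl (c : K) (f g : coordRing) : c *: (f * g) = (c *: f) * g.
Proof. by apply/val_inj/funext => x /=; exact: mulrA. Qed.

HB.instance Definition _ :=
  GRing.Lmodule_isLalgebra.Build K coordRing coord_scaleAl.
HB.instance Definition _ := GRing.Lalgebra_isComAlgebra.Build K coordRing.

Definition coord_unit : {pred coordRing} :=
  [pred f : coordRing | `[< exists g : coordRing, g * f = 1 >] ].

Definition coord_inv (f : coordRing) : coordRing :=
  if pselect (exists g : coordRing, g * f = 1) is left e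
  then projT1 (cid e) else f.

Fact coord_mulVx : {in coord_unit, left_inverse 1 coord_inv *%R}.
Proof.
move=> f /asboolP e; rewrite /coord_inv.
by case: pselect => // e'; exact: projT2 (cid e').
Qed.

Fact coord_unitPl (f g : coordRing) : g * f = 1 -> coord_unit f.
Proof. by move=> e; apply/asboolP; exists g. Qed.

Fact coord_inv_out : {in [predC coord_unit], coord_inv =1 id}.
Proof.
move=> f /asboolP e; rewrite /coord_inv.
by case: pselect => // e'; case: e.
Qed.

HB.instance Definition _ := GRing.ComNzRing_hasMulInverse.Build coordRing
  coord_mulVx coord_unitPl coord_inv_out.

(* Each diagonal {i, j} is listed once, with i < j; ordS is the cyclic        *)
(* successor. The formula for u_ij is symmetric in i and j.                   *)
Definition is_diag (p : 'I_n * 'I_n) : bool :=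
  [&& (p.1 < p.2)%N, p.2 != ordS p.1 & p.1 != ordS p.2].

Definition diag := {p : 'I_n * 'I_n | is_diag p}.
HB.instance Definition _ := Finite.on diag.

Definition dihedral_ratio (p : 'I_n * 'I_n) (M : 'M[K]_(n, 2)) : K :=
  let: (i, j) := p in
  (bracket M i (ordS j) * bracket M (ordS i) j) /
  (bracket M i j * bracket M (ordS i) (ordS j)).

Definition dihedral_fun (d : diag) (x : M0) : K :=
  dihedral_ratio (sval d) (std_coords (repr x)).

Lemma ordS_inj : injective (@ordS n).
Proof. exact: can_inj (@ordSK n). Qed.

Lemma dihedral_funE (d : diag) s M : homog_coords M s ->
  dihedral_fun d (\pi_M0 s) = dihedral_ratio (sval d) M.
Proof.
move=> Ms; rewrite /dihedral_fun.
set t := repr _; set N := std_coords t.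
have Nt : homog_coords N t := std_coordsP t.
have : pgl_equiv s t by apply/eqmodP; rewrite reprK.
move=> /asboolP[g gu e].
have /all_sig[a aE] i : {a : K | row i N = a *: (row i M *m g)}.
  apply: cid; have := e i; rewrite Nt Ms /gl_act limg_line lfunE /= => e'.
  by apply/vlineP; rewrite -e' memv_line.
have ordE (P : 'I_2 -> K) : \sum_k P k = P 0 + P 1.
  by rewrite big_ord_recl big_ord1; congr (_ + P _); apply: val_inj.
have NE i c : N i c = a i * (M i 0 * g 0 c + M i 1 * g 1 c).
  by have /rowP/(_ c) := aE i; rewrite !mxE ordE !mxE.
have bE i j : bracket N i j =
    a i * a j * (g 0 0 * g 1 1 - g 0 1 * g 1 0) * bracket M i j.
  by rewrite /bracket !NE; ring.
case: d => [[i j] /= /and3P[/= ij ij1 ji1]].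
have nij : i != j by apply: contraTneq ij => ->; rewrite ltnn.
have nS : ordS i != ordS j by rewrite (inj_eq ordS_inj).
have := bracket_neq0 Nt nS; have := bracket_neq0 Nt nij; rewrite !bE.
rewrite !mulf_eq0 !negb_or -!andbA => /and4P[ai aj g0 b1] /and4P[aSi aSj _ b2].
by field; rewrite ?ai ?aj ?aSi ?aSj ?g0 ?b1 ?b2.
Qed.

Lemma dihedral_crep (d : diag) : crep (dihedral_ratio (sval d)) /\
  crep (fun M => (dihedral_ratio (sval d) M)^-1).
Proof.
case: d => [[i j] /= /and3P[/= ij ij1 ji1]].
have nij : i != j by apply: contraTneq ij => ->; rewrite ltnn.
have nS : ordS i != ordS j by rewrite (inj_eq ordS_inj).
have V := crep_bracketV; have B := crep_bracket.
have nijS : i != ordS j by [].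
have nSij : ordS i != j by rewrite eq_sym.
split.
  have := crepM (crepM (B i (ordS j)) (B (ordS i) j)) (crepM (V _ _ nij) (V _ _ nS)).
  by congr crep; apply/funext => M; rewrite /= invfM.
have := crepM (crepM (B i j) (B (ordS i) (ordS j))) (crepM (V _ _ nijS) (V _ _ nSij)).
by congr crep; apply/funext => M; rewrite /= invf_div invfM.
Qed.

Fact dihedral_regular d : dihedral_fun d \in regular_fun.
Proof.
exact: regularP (fun s M Ms => dihedral_funE d Ms) (dihedral_crep d).1.
Qed.

Definition dihedral (d : diag) : coordRing := MkCoord (dihedral_regular d).

Fact dihedral_is_unit d : dihedral d \is a GRing.unit.
Proof.
have Vr : (fun x => (dihedral_fun d x)^-1) \in regular_fun.
  by apply: regularP (dihedral_crep d).2 => s M Ms; rewrite (dihedral_funE d Ms).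
apply/asboolP; exists (MkCoord Vr); apply/val_inj/funext => x /=.
apply: mulVf; rewrite /dihedral_fun; have := std_coordsP (repr x).
move: (std_coords _) => M Ms.
case: d {Vr} => [[i j] /= /and3P[/= ij ij1 ji1]].
have nij : i != j by apply: contraTneq ij => ->; rewrite ltnn.
have nS : ordS i != ordS j by rewrite (inj_eq ordS_inj).
rewrite mulf_neq0 ?invr_eq0 // mulf_neq0 //; apply: bracket_neq0 Ms _ => //.
by rewrite eq_sym.
Qed.

Definition dihedral_unit (d : diag) : units coordRing :=
  Units (dihedral_is_unit d).

Definition laurent_monomial (X : {ffun diag -> int}) : coordRing :=
  \prod_d dihedral d ^ X d.

Fact laurent_monomial_is_unit X : laurent_monomial X \is a GRing.unit.
Proof.
by apply: rpred_prod => d _; rewrite unitrXz ?dihedral_is_unit.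
Qed.

Definition monomial_unit (X : {ffun diag -> int}) : units coordRing :=
  Units (laurent_monomial_is_unit X).

(* The character lattice of the intrinsic torus of M_{0,n}. *)
Definition Lambda : zmodType := char_lattice coordRing.

Definition dihedral_class (d : diag) : Lambda := unit_class (dihedral_unit d).

Definition monomial_class (X : {ffun diag -> int}) : Lambda :=
  unit_class (monomial_unit X).

End Moduli.

(* Main.v *)
Require Import Defs.
From HB Require Import structures.
From mathcomp Require Import all_boot all_order all_algebra.
From mathcomp Require Import generic_quotient ring_quotient.
From mathcomp Require Import boolp reals complex mpoly ring zify.
Import Order.TTheory GRing.Theory Num.Theory.
Local Open Scope ring_scope.

Set Implicit Arguments.
Unset Strict Implicit.
Unset Printing Implicit Defensive.

(**
Send the point of index 0 to infinity, so that a configuration is given by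
distinct affine coordinates [sigma i], [i <> 0], up to affine maps ([frame]).

_Spanning._ A unit [f] of the coordinate ring and its inverse become fractions
of polynomials in the [sigma i] over powers of the Vandermonde product of the
forms ['X_i - 'X_j].  Each of these forms is prime, because a polynomial is
divisible by ['X_i - 'X_j] as soon as substituting ['X_j] for ['X_i] kills it
([root_form_prime]); hence the numerator of [f] is a constant times a product
of such forms ([dvd_prod_root_forms], [unit_frame]).  It remains to write
[sigma a - sigma b] as a monomial in the dihedral coordinates.  In the
logarithm, [u_ij] is a mixed second difference of [sigma i - sigma j], so the
product of the [u_ij] over all [i < a < b <= j] telescopes to
[sigma a - sigma b].  The only non-diagonal pair in this range is (0, last),
and it contributes [sigma 1 - sigma last]; the remaining affine freedom is used
to make this difference 1 ([exists_normalized], [sep_monomial]).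

_Independence._ Let the points of the cyclic interval [i < k <= j] collide:
[sigma k] is multiplied by a parameter [t] that tends to 0.  The bracket of
two points has order 1 in [t] when both collide and order 0 otherwise, so the
order of [u_kl] is minus the product of the jumps of the indicator function of
the interval at [k] and at [l], namely 1 if [{k, l} = {i, j}] and 0 otherwise
([order_collision_dihedral]).  These orders of vanishing are thus dual to the
dihedral coordinates, and a constant monomial has all its exponents zero
([laurent_monomial_scalar]).

The isomorphism of tori is a formal consequence of the basis property: a
morphism from a free abelian group amounts to its values on a basis
([torus_iso_of_Zbasis]).
*)

(** * Polynomials over a field of characteristic zero *)

Lemma poly_horner_inj (K : numFieldType) (p q : {poly K}) :
  (forall t, p.[t] = q.[t]) -> p = q.
Proof.
move=> pq; apply/eqP; rewrite -subr_eq0; apply/eqP.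
set r := p - q; have r0 t : r.[t] = 0 by rewrite hornerD hornerN pq subrr.
apply: (@roots_geq_poly_eq0 _ r [seq i%:R | i <- iota 0 (size r)]).
- by apply/allP => x _; rewrite /root r0.
- by rewrite map_inj_uniq ?iota_uniq // => i j /eqP; rewrite eqr_nat => /eqP.
- by rewrite size_map size_iota.
Qed.

Lemma poly_horner_inj_generic (K : numFieldType) (r p q : {poly K}) :
  r != 0 -> (forall t, r.[t] != 0 -> p.[t] = q.[t]) -> p = q.
Proof.
move=> r0 pq; apply/eqP; rewrite -subr_eq0 -(mulIr_eq0 _ (mulIf r0)).
apply/eqP/poly_horner_inj => t; rewrite hornerM horner0.
have [->|/pq e] := eqVneq r.[t] 0; first by rewrite mulr0.
by rewrite hornerD hornerN e subrr mul0r.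
Qed.

Lemma digits_inj (d n : nat) (m m' : 'I_n -> nat) :
    (forall i, m i < d)%N -> (forall i, m' i < d)%N ->
  (\sum_i m i * d ^ i = \sum_i m' i * d ^ i)%N -> m =1 m'.
Proof.
elim: n m m' => [|n IH] m m' md m'd; first by move=> _ [].
have split_low (k : 'I_n.+1 -> nat) : (\sum_i k i * d ^ i =
    (\sum_i k (lift ord0 i) * d ^ i) * d + k ord0)%N.
  rewrite big_ord_recl expn0 muln1 addnC big_distrl; congr (_ + _)%N.
  by apply: eq_bigr => i _ /=; rewrite -mulnA -expnSr.
rewrite !split_low => e i.
have d_gt0 : (0 < d)%N by apply: leq_ltn_trans (md i).
have e0 : m ord0 = m' ord0.
  by have := congr1 (modn^~ d) e; rewrite /= !modnMDl !modn_small.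
have /IH e1 : (\sum_i m (lift ord0 i) * d ^ i =
               \sum_i m' (lift ord0 i) * d ^ i)%N.
  by move: e; rewrite e0 => /addIn/eqP; rewrite eqn_pmul2r // => /eqP.
by case: (unliftP ord0 i) => [j ->|-> //]; apply: e1.
Qed.

(** Kronecker substitution: with [d] larger than all exponents, evaluating at
    [(t, t^d, t^(d^2), ...)] sends distinct monomials to distinct powers of [t],
    which reduces the claim to one variable. *)
Lemma mpoly_meval_inj (K : numFieldType) (n : nat) (P Q : {mpoly K[n]}) :
  (forall v, P.@[v] = Q.@[v]) -> P = Q.
Proof.
move=> PQ; apply/eqP; rewrite -subr_eq0; apply/eqP.
set D := P - Q; have D0 v : D.@[v] = 0 by rewrite mevalB PQ subrr.
pose d := msize D; pose code (m : 'X_{1..n}) := (\sum_i m i * d ^ i)%N.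
pose kron : {poly K} := \sum_(m <- msupp D) D@_m *: 'X^(code m).
have kron0 : kron = 0.
  apply: poly_horner_inj => t; rewrite horner0 -(D0 (fun i => t ^+ (d ^ i))).
  rewrite mevalE horner_sum; apply: eq_bigr => m _.
  rewrite hornerZ hornerXn /code expr_sum; congr (_ * _).
  by apply: eq_bigr => i _; rewrite mulnC exprM.
have small m i : m \in msupp D -> (m i < d)%N.
  move=> /msize_mdeg_lt; apply: leq_ltn_trans.
  by rewrite mdegE (bigD1 i) //= leq_addr.
apply/mpolyP => m0; rewrite mcoeff0.
have [m0D|/memN_msupp_eq0//] := boolP (m0 \in msupp D).
have := congr1 (fun p : {poly K} => p`_(code m0)) kron0.
rewrite coef0 coef_sum (bigD1_seq m0) ?msupp_uniq //= coefZ coefXn eqxx mulr1.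
rewrite big1_seq ?addr0 // => m /andP[mm0 mD]; rewrite coefZ coefXn.
case: eqP => [e|_]; last by rewrite mulr0.
case/eqP: mm0; apply/mnmP => i.
by apply: (digits_inj (d := d)) (esym e) i => i; apply: small.
Qed.

(** * Divisors of products of linear forms *)

Section LinearFactors.
Variables (K : numFieldType) (n : nat).
Implicit Types (P Q : {mpoly K[n]}) (i j : 'I_n) (s : seq ('I_n * 'I_n)).

Definition root_form (l : 'I_n * 'I_n) : {mpoly K[n]} := 'X_l.1 - 'X_l.2.

Definition merge_vars i j P : {mpoly K[n]} :=
  P \mPo [tuple 'X_(if k == i then j else k) | k < n].

Lemma merge_varsX i j k :
  merge_vars i j 'X_k = 'X_(if k == i then j else k).
Proof. by rewrite /merge_vars comp_mpolyXU -tnth_nth tnth_mktuple. Qed.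

(** Modulo ['X_i - 'X_j], the variables ['X_i] and ['X_j] agree, hence so do [P]
    and its image under the substitution. *)
Lemma root_form_dvd_merge i j P :
  exists Q, P = merge_vars i j P + root_form (i, j) * Q.
Proof.
have dvdM A B : (exists Q, A = merge_vars i j A + root_form (i, j) * Q) ->
    (exists Q, B = merge_vars i j B + root_form (i, j) * Q) ->
    exists Q, A * B = merge_vars i j (A * B) + root_form (i, j) * Q.
  move=> [Q eA] [R eB]; rewrite {1}eA {1}eB /merge_vars rmorphM.
  set a := _ \mPo _; set b := _ \mPo _.
  by exists (a * R + b * Q + root_form (i, j) * Q * R); ring.
have dvd1 : exists Q, 1 = merge_vars i j 1 + root_form (i, j) * Q.
  by exists 0; rewrite /merge_vars rmorph1 mulr0 addr0.
have dvdX m : exists Q, 'X_[m] = merge_vars i j 'X_[m] + root_form (i, j) * Q.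
  rewrite mpolyXE_id; elim/big_ind: _ => // k _.
  elim: (m k) => // e IH; rewrite exprS; apply: dvdM IH.
  rewrite merge_varsX; case: eqP => [->|_].
    by exists 1; rewrite /root_form /=; ring.
  by exists 0; rewrite mulr0 addr0.
elim/mpolyind: P => [|c m P _ _ [Q eP]].
  by exists 0; rewrite /merge_vars rmorph0 mulr0 addr0.
have [R eX] := dvdX m; exists (c *: R + Q).
rewrite {1}eP {1}eX /merge_vars comp_mpolyD comp_mpolyZ scalerDr mulrDr.
by rewrite -scalerAr addrACA.
Qed.

(** Modulo ['X_i - 'X_j] every polynomial is represented by its image under
    [merge_vars], so the quotient embeds in a polynomial ring, a domain. *)
Lemma root_form_prime i j P Q R : P * Q = root_form (i, j) * R ->
  (exists P', P = root_form (i, j) * P') \/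
  (exists Q', Q = root_form (i, j) * Q').
Proof.
move=> e; have : merge_vars i j P * merge_vars i j Q = 0.
  rewrite /merge_vars -rmorphM e rmorphM /root_form /= comp_mpolyB.
  rewrite -!/(merge_vars i j _) !merge_varsX eqxx.
  by case: ifP => _; rewrite subrr mul0r.
have [P' eP] := root_form_dvd_merge i j P.
have [Q' eQ] := root_form_dvd_merge i j Q.
move/eqP; rewrite mulf_eq0 => /orP[] /eqP z.
  by left; exists P'; rewrite {1}eP z add0r.
by right; exists Q'; rewrite {1}eQ z add0r.
Qed.

Lemma root_form_neq0 l : l.1 != l.2 -> root_form l != 0.
Proof.
case: l => i j /= ij; apply/eqP => /(congr1 (mcoeff U_(i)%MM)).
rewrite mcoeffB !mcoeffXU mcoeff0 eqxx [j == i]eq_sym (negbTE ij) subr0.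
by move/eqP; rewrite oner_eq0.
Qed.

(** Unique factorization, for these products only: the prime factors of the
    right-hand side are cancelled one at a time, each against [P] or [Q]. *)
Lemma dvd_prod_root_forms s P Q : all (fun l => l.1 != l.2) s ->
    P * Q = \prod_(l <- s) root_form l ->
  exists2 s', {subset s' <= s} &
    exists c, P = c%:MP * \prod_(l <- s') root_form l.
Proof.
elim: s P Q => [|[i j] s IH] P Q.
  rewrite big_nil => _ e; exists [::] => //; exists (P@_0).
  rewrite big_nil mulr1; apply/eqP.
  by have /andP[] := mpoly_intro_unit (etrans (mulrC Q P) e).
case/andP=> /root_form_neq0 ij0 s0; rewrite big_cons => e.
have [[P' eP]|[Q' eQ]] := root_form_prime e.
  have [|s' sub [c ec]] := IH P' Q s0.
    by apply: (mulfI ij0); rewrite mulrA -eP.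
  exists ((i, j) :: s').
    move=> l; rewrite !inE => /orP[->//|/sub ->]; exact: orbT.
  by exists c; rewrite eP ec big_cons mulrCA.
have [|s' sub ec] := IH P Q' s0.
  by apply: (mulfI ij0); rewrite mulrCA -eQ.
by exists s' => // l /sub; rewrite inE orbC => ->.
Qed.

End LinearFactors.

(** * Order of vanishing at zero *)

Section VanishingOrder.
Variable K : numFieldType.
Implicit Types (h : K -> K) (m : int) (p q r : {poly K}).

(** The nonzero polynomial [r] discards finitely many parameters, at which [h]
    need not be given by the fraction. *)
Definition order_at0 h m := exists p q r,
  [/\ p.[0] != 0, q.[0] != 0, r != 0 &
      forall t, r.[t] != 0 -> h t = t ^ m * (p.[t] / q.[t])].

Lemma horner0_neq0 p : p.[0] != 0 -> p != 0.
Proof. by apply: contraNneq => ->; rewrite horner0. Qed.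

Lemma order_at0_cst c : c != 0 -> order_at0 (fun=> c) 0.
Proof.
move=> c0; exists c%:P, 1, 1; split; rewrite ?hornerC ?oner_eq0 //.
by move=> t _; rewrite expr0z !hornerC mul1r divr1.
Qed.

Lemma order_at0_horner e p : p.[0] != 0 ->
  order_at0 (fun t => ('X^e * p).[t]) e%:Z.
Proof.
move=> p0; exists p, 1, 1; split; rewrite ?hornerC ?oner_eq0 //.
by move=> t _; rewrite hornerM hornerXn hornerC divr1.
Qed.

Lemma order_at0M h h' m m' : order_at0 h m -> order_at0 h' m' ->
  order_at0 (fun t => h t * h' t) (m + m').
Proof.
move=> [p [q [r [p0 q0 r0 H]]]] [p' [q' [r' [p0' q0' r0' H']]]].
exists (p * p'), (q * q'), ('X * (r * r')); split; rewrite ?hornerM ?mulf_neq0 //.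
  by rewrite polyX_eq0.
move=> t; rewrite !hornerM hornerX !mulf_eq0 !negb_or => /and3P[t0 rt rt'].
by rewrite H // H' // expfzDr // invfM mulrACA (mulrACA p.[t]).
Qed.

Lemma order_at0V h m : order_at0 h m -> order_at0 (fun t => (h t)^-1) (- m).
Proof.
move=> [p [q [r [p0 q0 r0 H]]]]; exists q, p, r; split=> // t /H ->.
by rewrite invfM invf_div invr_expz.
Qed.

Lemma order_at0X h m (e : int) :
  order_at0 h m -> order_at0 (fun t => h t ^ e) (m * e).
Proof.
move=> ho; have pos (k : nat) : order_at0 (fun t => h t ^+ k) (m * k).
  elim: k => [|k IH]; first by rewrite mulr0; apply: order_at0_cst (oner_neq0 _).
  under eq_fun do rewrite exprS.
  by rewrite -natz mulrS mulrDr mulr1 natz; apply: order_at0M.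
case: e => k; first exact: pos.
by rewrite NegzE mulrN; apply: order_at0V (pos k.+1).
Qed.

Lemma order_at0_prod (I : finType) (h : I -> K -> K) (m : I -> int) :
    (forall i, order_at0 (h i) (m i)) ->
  order_at0 (fun t => \prod_i h i t) (\sum_i m i).
Proof.
move=> ho; elim: (index_enum I) => [|i s IH].
  rewrite big_nil; under eq_fun do rewrite big_nil.
  exact: order_at0_cst (oner_neq0 _).
rewrite big_cons; under eq_fun do rewrite big_cons.
exact: order_at0M.
Qed.

(** Clear the denominators: [t ^ m * p] and [c * q] agree as polynomials (with
    [t ^ m] moved to the other side if [m < 0]), and at [t = 0] exactly one of
    the two sides would vanish if [m] were nonzero. *)
Lemma order_at0_cst_eq0 h m c r : order_at0 h m -> c != 0 -> r != 0 ->
  (forall t, r.[t] != 0 -> h t = c) -> m = 0.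
Proof.
move=> [p [q [r' [p0 q0 r0' H]]]] c0 r0 hc.
have good0 : 'X * (r * (r' * q)) != 0.
  by rewrite !mulf_neq0 ?polyX_eq0 ?r0 ?r0' ?(horner0_neq0 q0).
have good t : ('X * (r * (r' * q))).[t] != 0 ->
    [/\ t != 0, q.[t] != 0 & t ^ m * p.[t] = c * q.[t]].
  rewrite !hornerM hornerX !mulf_eq0 !negb_or => /and4P[t0 rt rt' qt].
  by split=> //; rewrite -(hc t) // H // mulrA mulrVK ?unitfE.
case: m H good => [[//|k]|k] H good.
  have /(congr1 (fun f : {poly K} => f.[0])) : 'X^(k.+1) * p = c *: q.
    apply: poly_horner_inj_generic good0 _ => t /good[_ _ e].
    by rewrite hornerM hornerXn hornerZ -e.
  rewrite hornerM hornerXn expr0n mul0r hornerZ => /esym/eqP.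
  by rewrite mulf_eq0 (negbTE c0) (negbTE q0).
have /(congr1 (fun f : {poly K} => f.[0])) : p = c *: ('X^(k.+1) * q).
  apply: poly_horner_inj_generic good0 _ => t /good[t0 _ e].
  rewrite hornerZ hornerM hornerXn mulrCA -e NegzE -exprnN mulrA divff ?mul1r //.
  by rewrite expf_neq0.
rewrite hornerZ hornerM hornerXn expr0n mul0r mulr0 => /eqP.
by rewrite (negbTE p0).
Qed.

End VanishingOrder.

Lemma ord2P (c : 'I_2) : c = 0 \/ c = 1.
Proof. by case: c => [[|[|//]] p]; [left|right]; apply: val_inj. Qed.

Lemma unitmx2 (K : fieldType) (A : 'M[K]_2) :
  A 0 0 * A 1 1 - A 0 1 * A 1 0 != 0 -> A \in unitmx.
Proof.
rewrite unitmxE unitfE; congr (_ != _); rewrite (expand_det_row A 0).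
rewrite big_ord_recl big_ord1 /cofactor !det_mx11 !mxE.
have -> : lift 0 (0 : 'I_1) = 1 :> 'I_2 by apply: val_inj.
have -> : lift 1 (0 : 'I_1) = 0 :> 'I_2 by apply: val_inj.
by rewrite expr0 expr1 mul1r mulN1r mulrN.
Qed.

(** * Homogeneous coordinates of configurations *)

Section Configurations.
Variables (K : numFieldType) (n : nat).
Implicit Types (M N : 'M[K]_(n, 2)) (s : config K n).

Lemma vline_scale (a : K) (v : 'rV[K]_2) : a != 0 -> <[a *: v]>%VS = <[v]>%VS.
Proof.
move=> a0; apply/eqP; rewrite eqEsubv -!memvE memvZ ?memv_line //=.
by apply/vlineP; exists a^-1; rewrite scalerA mulVf ?scale1r.
Qed.

Lemma pi_M0_eq s s' M N (g : 'M[K]_2) (a : 'I_n -> K) :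
    homog_coords M s -> homog_coords N s' -> g \in unitmx ->
    (forall i, a i != 0) -> (forall i, row i N = a i *: (row i M *m g)) ->
  \pi_(M0 K n)%qT s = \pi_(M0 K n)%qT s'.
Proof.
move=> Ms Ns' gU a0 NE; apply/eqmodP/asboolP; exists g => // i.
by rewrite Ms Ns' /gl_act limg_line lfunE /= NE vline_scale.
Qed.

Lemma config_of_brackets M : (1 < n)%N ->
    (forall i j, i != j -> bracket M i j != 0) ->
  exists s, homog_coords M s.
Proof.
move=> n1 b0.
have row0 i : row i M != 0.
  have [j ij] : exists j, i != j.
    have i0 : (0 < n)%N by apply: ltnW.
    case: (eqVneq i (Ordinal i0)) => [->|]; last by exists (Ordinal i0).
    by exists (Ordinal n1).
  apply: contraNneq (b0 _ _ ij) => /rowP r0; apply/eqP; rewrite /bracket.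
  by have := r0 0; have := r0 1; rewrite !mxE => -> ->; rewrite !mul0r subrr.
have dim1 i : \dim <[row i M]>%VS == 1%N by rewrite dim_vline row0.
have inj : injectiveb [ffun i => MkP1 (dim1 i)].
  apply/injectiveP => i j; rewrite !ffunE => /(congr1 (@line K)) /= e.
  apply/eqP; apply: contra_eqT e => /b0 ij; apply/eqP => e.
  have /vlineP[a /rowP ra] : row i M \in <[row j M]>%VS by rewrite -e memv_line.
  case/eqP: ij; rewrite /bracket.
  by have := ra 0; have := ra 1; rewrite !mxE => -> ->; ring.
by exists (MkConfig inj) => i; rewrite /= ffunE.
Qed.

End Configurations.

Lemma ord_eqE m (a b : 'I_m) : (a == b) = (a == b :> nat).
Proof. by []. Qed.

(** With [c m] the indicator of [inI m], the left-hand side is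
    [- (c k.+1 - c k) * (c l.+1 - c l)].  The jumps of [c] are +1 at [i] and -1
    at [j], and since [k < l] the product is nonzero only for [k = i], [l = j]. *)
Lemma second_difference_interval (i j k l : nat) :
    (i < j)%N -> (k.+1 < l)%N -> let inI m := (i < m <= j)%N in
  (inI k && inI l.+1)%:Z + (inI k.+1 && inI l)%:Z
    - ((inI k && inI l)%:Z + (inI k.+1 && inI l.+1)%:Z)
  = ((k == i) && (l == j))%:Z.
Proof.
move=> ij kl /=; rewrite (eq_sym k) (eq_sym l) !ltnS.
by case: (ltngtP i k); case: (ltngtP l j); move=> *; subst; lia.
Qed.

(** * Configurations with one point at infinity *)

Section Frame.
Variables (K : numFieldType) (n : nat).
Hypothesis n3 : (3 <= n)%N.
Local Notation M0 := (M0 K n.+1).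
Local Notation diag := (diag n.+1).
Implicit Types (x : M0) (s : config K n.+1) (sigma : 'I_n.+1 -> K).
Implicit Types (X : {ffun diag -> int}).

(** The indices of [sigma] include that of the point at infinity, so that points,
    coordinates and polynomial variables are numbered alike. *)
Definition frame sigma : 'M[K]_(n.+1, 2) :=
  \matrix_(i, c) if c == 0 then if i == ord0 then 1 else sigma i
                 else (i != ord0)%:R.

Lemma bracket_frame sigma i j : bracket (frame sigma) i j =
  if i == ord0 then (j != ord0)%:R
  else if j == ord0 then -1 else sigma i - sigma j.
Proof.
rewrite /bracket !mxE /=.
case: eqP => _; case: eqP => _ /=;
  by rewrite !(mul1r, mulr1, mul0r, mulr0) ?sub0r ?subr0 ?oppr0.
Qed.

Definition second_point : 'I_n.+1 := inord 1.

Lemma val_second_point : second_point = 1%N :> nat.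
Proof. by rewrite inordK //; lia. Qed.

Definition normalized sigma s :=
  homog_coords (frame sigma) s /\ sigma second_point - sigma ord_max = 1.

(** The linear forms [v |-> det (v, r_last)] and [v |-> det (v, r_0)], where
    [r_i] is the i-th row, send the point 0 to infinity and the last point to 0;
    the factor [kappa] on the first form moves the second point to 1.  So
    [sigma] is a cross-ratio with the points 0, 1 and last. *)
Lemma exists_normalized x :
  exists s sigma, x = \pi_M0%qT s /\ normalized sigma s.
Proof.
have [M Mt] : exists M, homog_coords M (repr x).
  by exists (std_coords (repr x)); apply: std_coordsP.
pose b := bracket M; have b0 i j : i != j -> b i j != 0 := bracket_neq0 Mt.
have ne01 : second_point != ord0 by rewrite -val_eqE /= val_second_point.
have ne0l : ord_max != ord0 :> 'I_n.+1 by rewrite -val_eqE /=; lia.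
have ne1l : second_point != ord_max by rewrite -val_eqE /= val_second_point; lia.
have [kappa kappaE kappa0] : exists2 kappa,
    kappa * b second_point ord_max = b second_point ord0 & kappa != 0.
  exists (b second_point ord0 / b second_point ord_max).
    by rewrite divfK ?b0.
  by rewrite mulf_neq0 ?invr_eq0 ?b0.
pose sigma i := kappa * b i ord_max / b i ord0.
pose g : 'M[K]_2 := \matrix_(c, d)
  if d == 0 then kappa * (if c == 0 then M ord_max 1 else - M ord_max 0)
  else if c == 0 then M ord0 1 else - M ord0 0.
pose a i := if i == ord0 then (kappa * b ord0 ord_max)^-1 else (b i ord0)^-1.
have gU : g \in unitmx.
  apply: unitmx2; rewrite !mxE /=.
  rewrite (_ : _ - _ = kappa * b ord_max ord0) ?mulf_neq0 ?b0 //.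
  by rewrite /b /bracket; ring.
have a0 i : a i != 0.
  rewrite /a; have [_|i0] := eqVneq i ord0.
    by rewrite invr_eq0 mulf_neq0 // b0 // eq_sym.
  by rewrite invr_eq0 b0.
have sum2 (P : 'I_2 -> K) : \sum_k P k = P 0 + P 1.
  by rewrite big_ord_recl big_ord1; congr (_ + P _); apply: val_inj.
have rowE i : row i (frame sigma) = a i *: (row i M *m g).
  apply/rowP => c; rewrite !mxE sum2 !mxE /a.
  case: (eqVneq i ord0) => [->|i0].
    have := b0 _ _ ne0l.
    rewrite [b ord_max _](_ : _ = - b ord0 ord_max) ?oppr_eq0.
      move=> bl; case: (ord2P c) => -> /=.
        rewrite (_ : M _ _ * _ + _ = kappa * b ord0 ord_max) ?mulVf ?mulf_neq0 //.
        by rewrite /b /bracket; ring.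
      by rewrite (_ : M _ _ * _ + _ = 0) ?eqxx ?mulr0 //; ring.
    by rewrite /b /bracket; ring.
  have bi := b0 _ _ i0; case: (ord2P c) => -> /=.
    rewrite /sigma mulrC; congr (_ * _).
    by rewrite /b /bracket; ring.
  by rewrite (_ : M _ _ * _ + _ = b i ord0) ?mulVf // /b /bracket; ring.
have [s Fs] : exists s, homog_coords (frame sigma) s.
  apply: config_of_brackets => [|i j ij]; first by lia.
  have -> : bracket (frame sigma) i j =
      a i * a j * (g 0 0 * g 1 1 - g 0 1 * g 1 0) * b i j.
    have FE k c : frame sigma k c = a k * (M k 0 * g 0 c + M k 1 * g 1 c).
      by have /rowP/(_ c) := rowE k; rewrite !mxE sum2 !mxE.
    by rewrite /b /bracket !FE; ring.
  rewrite !mulf_neq0 ?a0 ?b0 //.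
  rewrite !mxE /= (_ : _ - _ = kappa * b ord_max ord0) ?mulf_neq0 ?b0 //.
  by rewrite /b /bracket; ring.
exists s, sigma; split.
  by rewrite -[x]reprK; apply: pi_M0_eq Mt Fs gU a0 rowE.
split=> //; rewrite /sigma (_ : b ord_max ord_max = 0); last first.
  by rewrite /b /bracket; ring.
by rewrite mulr0 mul0r subr0 kappaE divff ?b0.
Qed.

Lemma frame_neq sigma s (i j : 'I_n.+1) : homog_coords (frame sigma) s ->
  (0 < i)%N -> (0 < j)%N -> i != j -> sigma i - sigma j != 0.
Proof.
move=> Fs i0 j0 /(bracket_neq0 Fs).
by rewrite bracket_frame -!val_eqE /= !gtn_eqF.
Qed.

(** * Telescoping products of dihedral coordinates *)

(** The difference [sigma i - sigma j], indexed by natural numbers so that [n.+1]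
    can stand for the point 0 reached after a full turn.  Pairs involving the
    point at infinity get the value 1, which is their bracket up to sign. *)
Definition sep sigma (i j : nat) : K :=
  if [&& 0 < i, i < j & j <= n]%N then sigma (inord i) - sigma (inord j) else 1.

(** [u_ij] as a function of [i] and [j]; unlike [dihedral_ratio], it is also
    used at pairs that are not diagonals. *)
Definition sep_ratio sigma (i j : nat) : K :=
  (sep sigma i j.+1 * sep sigma i.+1 j) / (sep sigma i j * sep sigma i.+1 j.+1).

Lemma sep_neq0 sigma s i j : homog_coords (frame sigma) s -> sep sigma i j != 0.
Proof.
move=> Fs; rewrite /sep; case: ifP => [/and3P[i0 ij jn]|_]; last exact: oner_neq0.
have [iE jE] : (inord i : 'I_n.+1) = i :> nat /\ (inord j : 'I_n.+1) = j :> nat.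
  by rewrite !inordK //; lia.
by apply: frame_neq Fs _ _ _; rewrite -?val_eqE /= ?iE ?jE; lia.
Qed.

(** For fixed [i] the product over [j] telescopes to
    [sep i.+1 b / sep i b], since [j] ends at the point at infinity; the product
    over [i] then telescopes to [sep a b], since [i] starts there. *)
Lemma prod_sep_ratio sigma s a b : homog_coords (frame sigma) s ->
  (0 < a)%N -> (b <= n)%N ->
  \prod_(0 <= i < a) \prod_(b <= j < n.+1) sep_ratio sigma i j = sep sigma a b.
Proof.
move=> Fs a0 bn; have s0 i j : sep sigma i j != 0 := sep_neq0 i j Fs.
have s_row0 j : sep sigma 0 j = 1 by rewrite /sep.
have s_far i : sep sigma i n.+1 = 1 by rewrite /sep ltnn !andbF.
rewrite (@telescope_prodf_eq _ _ _ (sep sigma ^~ b)) // ?s_row0 ?divr1 //.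
move=> i _.
pose F j := sep sigma i j / sep sigma i.+1 j.
rewrite (@telescope_prodf_eq _ _ _ F) //; last first.
- by move=> j _; rewrite /sep_ratio /F invf_div mulf_div [_ i j * _]mulrC
    [X in X / _]mulrC mulrC.
- by move=> j _; rewrite mulf_neq0 ?invr_eq0.
by rewrite /F !s_far divr1 mul1r invf_div.
Qed.

Lemma ordS_lt (k : 'I_n.+1) : (k < n)%N -> ordS k = k.+1 :> nat.
Proof. by move=> kn; rewrite /= modn_small. Qed.

Lemma ordS_last (k : 'I_n.+1) : k = n :> nat -> ordS k = ord0.
Proof. by move=> kn; apply: val_inj; rewrite /= kn modnn. Qed.

(** The case distinction is whether the successor of the larger endpoint wraps
    around to 0. *)
Lemma diagP (d : diag) :
  let: (k, l) := sval d in
  [/\ (k.+1 < l)%N, ordS k = k.+1 :> nat &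
      (l < n)%N /\ ordS l = l.+1 :> nat \/
      [/\ l = n :> nat, (0 < k)%N & ordS l = ord0]].
Proof.
case: d => [[k l] /= /and3P[/= kl lk kl']].
have kS : ordS k = k.+1 :> nat by apply: ordS_lt; have := ltn_ord l; lia.
split=> //.
  by move: lk; rewrite ord_eqE kS; lia.
have [ln|ln] := ltnP l n; first by left; split=> //; apply: ordS_lt.
have {}ln : l = n :> nat by have := ltn_ord l; lia.
right; split=> //; last exact: ordS_last.
by move: kl'; rewrite (ordS_last ln) ord_eqE /=; lia.
Qed.

Lemma bracket_sep sigma (i j : 'I_n.+1) : (i < j)%N ->
  bracket (frame sigma) i j = sep sigma i j.
Proof.
have jn : (j <= n)%N by rewrite -ltnS.
move=> ij; rewrite bracket_frame /sep ij jn !ord_eqE andbT /=.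
have [-> //|i0] := posnP i; first by rewrite -lt0n (leq_ltn_trans _ ij).
by rewrite gtn_eqF ?gtn_eqF ?(leq_ltn_trans _ ij) // !inord_val.
Qed.

(** When [ordS l] wraps around to 0, the brackets with the point 0 are -1
    instead of 1, but two of them occur, one above and one below. *)
Lemma dihedral_ratio_frame sigma (d : diag) :
  dihedral_ratio (sval d) (frame sigma) = sep_ratio sigma (sval d).1 (sval d).2.
Proof.
have := diagP d; case: (sval d) => k l [kl kS l_last].
rewrite /sep_ratio /dihedral_ratio [fst _]/= [snd _]/= -kS.
case: l_last => [[ln lS]|[ln k0 lS]].
  by rewrite -lS !bracket_sep // ?kS ?lS; lia.
have far i : sep sigma i l.+1 = 1 by rewrite /sep ln ltnn !andbF.
rewrite lS !far -!bracket_sep ?kS //; last by lia.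
rewrite (bracket_frame _ k ord0) (bracket_frame _ (ordS k) ord0).
by rewrite !ord_eqE kS gtn_eqF //= mulN1r mulrN1 mul1r mulr1 invrN mulrNN.
Qed.

(** In [prod_sep_ratio] all pairs [(i, j)] are diagonals except [(0, n)], whose
    ratio is [sep 1 n = 1] by the normalization. *)
Lemma sep_monomial (a b : 'I_n.+1) : (0 < a)%N -> (a < b)%N ->
  exists X, forall sigma s, normalized sigma s ->
    sigma a - sigma b = \prod_d dihedral_ratio (sval d) (frame sigma) ^ X d.
Proof.
move=> a0 ab.
pose inside (p : 'I_n.+1 * 'I_n.+1) := (p.1 < a)%N && (b <= p.2)%N.
exists [ffun d => (inside (sval d))%:Z] => sigma s [Fs sigma1].
have -> : sigma a - sigma b = sep sigma a b.
  by rewrite -bracket_sep // bracket_frame -!val_eqE /= !gtn_eqF //; lia.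
have aN : (a <= n.+1)%N by apply: ltnW.
have bN : (b <= n)%N by rewrite -ltnS.
rewrite -(prod_sep_ratio Fs a0 bN) big_mkord.
rewrite (big_ord_widen _
  (fun i => \prod_(b <= j < n.+1) sep_ratio sigma i j) aN).
under [LHS]eq_bigr => i _ do
  rewrite (big_geq_mkord b n.+1 xpredT (sep_ratio sigma i)).
rewrite pair_big /= big_mkcond /=.
under [RHS]eq_bigr => d _ do rewrite dihedral_ratio_frame ffunE.
pose F (p : 'I_n.+1 * 'I_n.+1) := sep_ratio sigma p.1 p.2 ^ (inside p)%:Z.
rewrite -[RHS](big_sub (is_diag (n := n.+1)) F) [RHS]big_mkcond /=.
apply: eq_bigr => -[i j] _; rewrite /F /inside /= unfold_in.
case: (boolP (_ && _)) => [/andP[ia bj]|_]; last by rewrite expr0z if_same.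
rewrite expr1z; case: ifP => // /negbT ndiag.
have [i0 jn] : i = 0%N :> nat /\ j = n :> nat.
  move: ndiag; rewrite /is_diag /= (leq_trans (leq_trans ia (ltnW ab)) bj) /=.
  rewrite !ord_eqE ordS_lt; last by have := ltn_ord j; lia.
  have [jn|jn] := ltnP j n; first by rewrite ordS_lt //; lia.
  have {}jn : j = n :> nat by have := ltn_ord j; lia.
  by rewrite ordS_last //=; lia.
rewrite /sep_ratio i0 jn /sep /= ltnS lt0n ltnn !andbF !mul1r.
rewrite leqnn invr1 mulr1 ifT; last by lia.
rewrite -[RHS]sigma1; congr (sigma _ - sigma _).
by apply: val_inj; rewrite /= inordK.
Qed.

(** * Units are scalar multiples of Laurent monomials *)

Definition point_eval x (f : coordRing K n.+1) : K := f x.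

Fact point_eval_zmod x : zmod_morphism (point_eval x). Proof. by []. Qed.
Fact point_eval_monoid x : monoid_morphism (point_eval x). Proof. by []. Qed.
HB.instance Definition _ x := GRing.isZmodMorphism.Build
  (coordRing K n.+1) K (point_eval x) (point_eval_zmod x).
HB.instance Definition _ x := GRing.isMonoidMorphism.Build
  (coordRing K n.+1) K (point_eval x) (point_eval_monoid x).

Lemma laurent_monomialE X s M : homog_coords M s ->
  laurent_monomial K X (\pi_M0%qT s) =
    \prod_d dihedral_ratio (sval d) M ^ X d.
Proof.
move=> Ms; rewrite -[LHS]/(point_eval _ _) rmorph_prod; apply: eq_bigr => d _.
rewrite rmorphXz ?dihedral_is_unit //; congr (_ ^ _); exact: dihedral_funE.
Qed.

(** Pairs of points at finite distance, since the point 0 is at infinity. *)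
Definition finite_pairs : seq ('I_n.+1 * 'I_n.+1) :=
  [seq p : 'I_n.+1 * 'I_n.+1 <- index_enum _ | (0 < p.1)%N && (p.1 < p.2)%N].

Definition vandermonde : {mpoly K[n.+1]} :=
  \prod_(p <- finite_pairs) root_form K p.

Lemma meval_root_form sigma p : (root_form K p).@[sigma] = sigma p.1 - sigma p.2.
Proof. by rewrite mevalB !mevalXU. Qed.

Lemma disc_frame sigma : disc (frame sigma) = vandermonde.@[sigma].
Proof.
rewrite rmorph_prod /disc pair_big_dep /= /finite_pairs big_filter.
rewrite [RHS]big_mkcond [LHS]big_mkcond; apply: eq_bigr => -[i j] _ /=.
case ij: (i < j)%N; last by rewrite andbF.
rewrite bracket_frame meval_root_form !ord_eqE andbT /=.
have j0 := leq_ltn_trans (leq0n _) ij.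
by case: posnP => _; rewrite !gtn_eqF.
Qed.

Lemma vandermonde_neq0 : vandermonde != 0.
Proof.
rewrite /vandermonde big_seq prodf_seq_neq0; apply/allP => p _; apply/implyP.
rewrite mem_filter => /andP[/andP[_ p12] _]; apply: root_form_neq0.
by rewrite -val_eqE /= ltn_eqF.
Qed.

Lemma frame_config sigma : vandermonde.@[sigma] != 0 ->
  exists s, homog_coords (frame sigma) s.
Proof.
rewrite -disc_frame => d0; apply: config_of_brackets => [|i j ij]; first by lia.
have lt_neq0 (k l : 'I_n.+1) : (k < l)%N -> bracket (frame sigma) k l != 0.
  move=> kl; move: d0; rewrite /disc (bigD1 k) //= (bigD1 l) //=.
  by rewrite !mulf_eq0 !negb_or => /andP[/andP[]].
case: (ltngtP i j) => [/lt_neq0 //|/lt_neq0|/val_inj e].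
  rewrite (_ : bracket _ j i = - bracket (frame sigma) i j) ?oppr_eq0 //.
  by rewrite /bracket; ring.
by rewrite e eqxx in ij.
Qed.

(** Substitute the entries of [frame] into a polynomial representing [f] on
    homogeneous coordinates; [E] is the frame with indeterminate coordinates. *)
Lemma regular_frame (f : coordRing K n.+1) : exists (P : {mpoly K[n.+1]}) k,
  forall sigma s, homog_coords (frame sigma) s ->
    f (\pi_M0%qT s) = P.@[sigma] / vandermonde.@[sigma] ^+ k.
Proof.
have /asboolP[P [k fE]] := cfun_regular f.
pose E : 'M[{mpoly K[n.+1]}]_(n.+1, 2) := 
  \matrix_(i, c) if c == 0 then if i == ord0 then 1 else 'X_i
                 else (i != ord0)%:R.
exists (P \mPo [tuple mxvec E 0 i | i < n.+1 * 2]), k => sigma s Fs.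
rewrite (fE s _ Fs) disc_frame comp_mpoly_meval; congr (_ / _).
apply: meval_eq => i; rewrite tnth_mktuple.
have -> : frame sigma = map_mx (meval sigma) E.
  apply/matrixP => j c; rewrite !mxE; case: ifP => _; last by rewrite rmorph_nat.
  by case: ifP => _; rewrite ?rmorph1 ?mevalXU.
by rewrite -map_mxvec mxE.
Qed.

(** Clearing denominators in [g * f = 1] gives an identity [P * Q] = power of the
    Vandermonde product.  It holds a priori where this product is nonzero, and
    multiplying by it once more makes it hold at every [sigma]. *)
Lemma unit_frame (f g : coordRing K n.+1) : g * f = 1 ->
  exists2 ps : seq ('I_n.+1 * 'I_n.+1), {subset ps <= finite_pairs} &
  exists c k, forall sigma s, homog_coords (frame sigma) s ->
    f (\pi_M0%qT s) = c * (\prod_(p <- ps) (sigma p.1 - sigma p.2)) /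
      (\prod_(p <- finite_pairs) (sigma p.1 - sigma p.2)) ^+ k.
Proof.
move=> gf1; have [P [k fE]] := regular_frame f.
have [Q [l gE]] := regular_frame g.
have PQ : P * Q = vandermonde ^+ (k + l).
  apply: (mulIf vandermonde_neq0); apply: mpoly_meval_inj => sigma.
  rewrite !mevalM rmorphXn /=.
  have [->|d0] := eqVneq vandermonde.@[sigma] 0; first by rewrite !mulr0.
  have [s Fs] := frame_config d0; congr (_ * _).
  have : g (\pi_M0%qT s) * f (\pi_M0%qT s) = 1.
    by rewrite -[RHS]/((1 : coordRing K n.+1) (\pi_M0%qT s)) -gf1.
  rewrite (fE _ _ Fs) (gE _ _ Fs) mulf_div => /divr1_eq.
  by rewrite exprD mulrC => ->; rewrite mulrC.
have vandX e : vandermonde ^+ e =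
    \prod_(p <- flatten (nseq e finite_pairs)) root_form K p.
  by rewrite big_flatten big_nseq -Monoid.iteropE.
have [|ps sub [c cE]] := dvd_prod_root_forms _ (etrans PQ (vandX _)).
  apply/allP => p /flattenP[t /nseqP[-> _]]; rewrite mem_filter.
  by case/andP=> /andP[_ p12] _; rewrite -val_eqE /= ltn_eqF.
exists ps; first by move=> p /sub /flattenP[t /nseqP[-> _]].
have evalE r sigma : (\prod_(p <- r) root_form K p).@[sigma] =
    \prod_(p <- r) (sigma p.1 - sigma p.2).
  by rewrite rmorph_prod; apply: eq_bigr => p _; apply: meval_root_form.
exists c, k => sigma s Fs; rewrite (fE _ _ Fs) cE mevalM mevalC evalE.
by rewrite /vandermonde evalE.
Qed.

(** Functions of a normalized [sigma] that are monomials in the dihedral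
    coordinates form a group, which contains all [sigma a - sigma b]. *)
Lemma unit_laurent_monomial (f : coordRing K n.+1) : f \is a GRing.unit ->
  exists c X, f = c *: laurent_monomial K X.
Proof.
case/asboolP=> g gf1; have [ps sub [c [k fE]]] := unit_frame gf1.
pose monomial (h : ('I_n.+1 -> K) -> K) := exists X, forall sigma s,
  normalized sigma s ->
  h sigma = \prod_d dihedral_ratio (sval d) (frame sigma) ^ X d.
have ratio0 (d : diag) sigma s : homog_coords (frame sigma) s ->
    dihedral_ratio (sval d) (frame sigma) != 0.
  move=> Fs; rewrite -(dihedral_funE d Fs).
  have := rmorph_unit (point_eval (\pi_M0%qT s)) (dihedral_is_unit K d).
  by rewrite unitfE.
have monoM h h' : monomial h -> monomial h' ->
    monomial (fun sigma => h sigma * h' sigma).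
  move=> [X hX] [Y hY]; exists (X + Y) => sigma s Fs.
  rewrite (hX _ _ Fs) (hY _ _ Fs) -big_split /=; apply: eq_bigr => d _.
  by rewrite ffunE expfzDr // (ratio0 d _ _ Fs.1).
have mono1 : monomial (fun=> 1).
  by exists 0 => sigma s _; rewrite big1 // => d _; rewrite ffunE.
have monoV h : monomial h -> monomial (fun sigma => (h sigma)^-1).
  move=> [X hX]; exists (- X) => sigma s Fs; rewrite (hX _ _ Fs) -prodfV.
  by apply: eq_bigr => d _; rewrite ffunE invr_expz.
have mono_prod r : {subset r <= finite_pairs} ->
    monomial (fun sigma => \prod_(p <- r) (sigma p.1 - sigma p.2)).
  elim: r => [|p r IH] sub'; first by under eq_fun do rewrite big_nil.
  under eq_fun do rewrite big_cons; apply: monoM.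
    have := sub' p (mem_head _ _); rewrite mem_filter => /andP[/andP[p0 p12] _].
    exact: sep_monomial.
  by apply: IH => q qr; apply: sub'; rewrite inE qr orbT.
have monoX h e : monomial h -> monomial (fun sigma => h sigma ^+ e).
  move=> mh; elim: e => [|e IH]; first exact: mono1.
  by under eq_fun do rewrite exprS; apply: monoM.
have [X hX] := monoM _ _ (mono_prod ps sub)
  (monoV _ (monoX _ k (mono_prod finite_pairs (fun p => id)))).
exists c, X; apply/val_inj/funext => x /=.
have [s [sigma [-> Fs]]] := exists_normalized x.
rewrite -[LHS]/(f (\pi_M0%qT s)) (fE _ _ Fs.1) -mulrA (hX _ _ Fs).
by rewrite -(laurent_monomialE X Fs.1).
Qed.

(** * Independence of the dihedral coordinates *)

Section Collision.
Variables (i j : 'I_n.+1).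
Hypothesis ij : (i < j)%N.

Definition colliding (k : nat) := (i < k <= j)%N.

(** For [k > 0] the coordinates [k%:R] are distinct and nonzero, so at [t = 0]
    the points of the interval [i < k <= j] meet at 0, away from the others. *)
Definition collision (t : K) (k : 'I_n.+1) : K :=
  (if colliding k then t else 1) * k%:R.

Definition collision_bracket (k l : 'I_n.+1) : {poly K} :=
  if k == ord0 then (l != ord0)%:R else if l == ord0 then -1 else
  (if colliding k then 'X else 1) * k%:R - (if colliding l then 'X else 1) * l%:R.

Lemma collision_bracketE t k l :
  (collision_bracket k l).[t] = bracket (frame (collision t)) k l.
Proof.
rewrite bracket_frame /collision_bracket /collision.
case: ifP => _; first by case: eqP; rewrite hornerC.
case: ifP => _; first by rewrite hornerN hornerC.
rewrite hornerD hornerN !hornerM -!polyC_natr !hornerC.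
by congr (_ * _ - _ * _); case: ifP; rewrite ?hornerX ?hornerC.
Qed.

Lemma collision_bracket_factor k l : k != l -> exists2 q : {poly K}, q.[0] != 0 &
  collision_bracket k l = 'X^(colliding k && colliding l) * q.
Proof.
move=> kl; rewrite /collision_bracket.
have c0 : colliding (ord0 : 'I_n.+1) = false by rewrite /colliding ltn0.
have [k0|k0] := eqVneq k ord0.
  exists 1; first by rewrite hornerC oner_eq0.
  by rewrite k0 c0 mulr1 -k0 eq_sym kl.
have [l0|l0] := eqVneq l ord0.
  exists (-1); first by rewrite hornerN hornerC oppr_eq0 oner_eq0.
  by rewrite l0 c0 andbF mul1r.
have nz (m : 'I_n.+1) : m != ord0 -> m%:R != 0 :> K.
  by move=> m0; rewrite pnatr_eq0; exact: m0.
have kl0 : k%:R - l%:R != 0 :> K by rewrite subr_eq0 eqr_nat.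
case ck : (colliding k); case cl : (colliding l).
- exists (k%:R - l%:R)%:P; first by rewrite hornerC.
  by rewrite polyCB !polyC_natr mulrBr.
- exists ('X * k%:R - 1 * l%:R); last by rewrite expr0 [RHS]mul1r.
  rewrite hornerD hornerN !hornerM -!polyC_natr !hornerC hornerX.
  by rewrite mul0r sub0r mul1r oppr_eq0 nz.
- exists (1 * k%:R - 'X * l%:R); last by rewrite expr0 [RHS]mul1r.
  rewrite hornerD hornerN !hornerM -!polyC_natr !hornerC hornerX.
  by rewrite mul0r subr0 mul1r nz.
- exists (k%:R - l%:R)%:P; first by rewrite hornerC.
  by rewrite polyCB !polyC_natr expr0 !mul1r.
Qed.

Definition collision_disc : {poly K} :=
  \prod_(p : 'I_n.+1 * 'I_n.+1 | p.1 != p.2) collision_bracket p.1 p.2.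

Lemma collision_disc_neq0 : collision_disc != 0.
Proof.
apply/prodf_neq0 => p /collision_bracket_factor[q q0 ->].
by rewrite mulf_neq0 ?expf_neq0 ?polyX_eq0 ?(horner0_neq0 q0).
Qed.

Lemma collision_config t : collision_disc.[t] != 0 ->
  exists s, homog_coords (frame (collision t)) s.
Proof.
move=> d0; apply: config_of_brackets => [|k l kl]; first by lia.
rewrite -collision_bracketE.
apply: contraNneq d0 => e; rewrite /collision_disc (bigD1 (k, l)) //=.
by rewrite hornerM e mul0r.
Qed.

Lemma order_collision_dihedral (d : diag) :
  order_at0 (fun t => dihedral_ratio (sval d) (frame (collision t)))
    (sval d == (i, j))%:Z.
Proof.
have ord_b k l : k != l -> order_at0
    (fun t => bracket (frame (collision t)) k l) (colliding k && colliding l)%:Z.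
  case/collision_bracket_factor=> q q0 e.
  under eq_fun do rewrite -collision_bracketE e; exact: order_at0_horner.
have := diagP d; have : (sval d).1 != ordS (sval d).2 by case/and3P: (svalP d).
case: (sval d) => k l kSl [kl kS l_last].
have neq (a b : 'I_n.+1) : (a < b)%N -> a != b.
  by move=> lt_ab; rewrite ord_eqE; lia.
have Sneq : ordS k != ordS l by rewrite (inj_eq (@ordS_inj _)) neq //; lia.
have Skl : ordS k != l by rewrite neq // kS.
have kl' : k != l by rewrite neq //; lia.
have := order_at0M (order_at0M (ord_b _ _ kSl) (ord_b _ _ Skl))
  (order_at0V (order_at0M (ord_b _ _ kl') (ord_b _ _ Sneq))).
congr (order_at0 _ _).
rewrite xpair_eqE !ord_eqE.
rewrite [colliding (ordS l)](_ : _ = colliding l.+1); last first.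
  case: l_last => [[_ ->//]|[ln k0 ->]]; rewrite /colliding ltn0 /=.
  by have := ltn_ord j; lia.
rewrite kS; exact: second_difference_interval.
Qed.

End Collision.

(** The order of the monomial along the collision attached to the diagonal [d]
    is the exponent [X d], while a nonzero constant has order 0. *)
Lemma laurent_monomial_scalar X c :
  laurent_monomial K X = c%:A -> X = 0.
Proof.
move=> Xc; apply/ffunP => d; rewrite ffunE; case dE : (sval d) => [i j].
have ij : (i < j)%N by have := diagP d; rewrite dE; case; lia.
have c0 : c != 0.
  apply: contraTneq (laurent_monomial_is_unit K X) => c0.
  by rewrite Xc c0 scale0r unitr0.
have := order_at0_prod
  (fun e => order_at0X (X e) (order_collision_dihedral ij e)).
rewrite (bigD1 d) //= dE eqxx mul1r big1 ?addr0 => [|e ed]; last first.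
  by rewrite -dE (inj_eq val_inj) (negbTE ed) mul0r.
move/(@order_at0_cst_eq0 _ _ _ c (collision_disc i j)); apply=> //.
  exact: collision_disc_neq0.
move=> t /(collision_config ij)[s Fs]; rewrite -(laurent_monomialE X Fs) Xc.
by rewrite -[LHS]/(c * 1) mulr1.
Qed.

End Frame.

(** * The torus attached to a basis *)

Section TorusOfBasis.
Variables (K : fieldType) (L : zmodType) (I : finType) (e : I -> L).
Hypothesis basis_e : is_Zbasis e.

Definition basis_coord (x : L) : {ffun I -> int} := projT1 (cid (basis_e x)).

Lemma basis_coordK x : \sum_i e i *~ basis_coord x i = x.
Proof. by rewrite /basis_coord; case: cid => X /= []. Qed.

Lemma basis_coord_sum (X : {ffun I -> int}) :
  basis_coord (\sum_i e i *~ X i) = X.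
Proof.
have [Y [_ uniqY]] := basis_e (\sum_i e i *~ X i).
by rewrite -[RHS](uniqY X) //; apply/esym/uniqY; rewrite basis_coordK.
Qed.

Variables (B : comUnitAlgType K) (y : coord_torus I B).

Definition extend_point (x : L) : units B := \sum_i y i *~ basis_coord x i.

Fact extend_point_zmod : zmod_morphism extend_point.
Proof.
move=> u v; rewrite /extend_point -sumrB.
have -> : basis_coord (u - v) = basis_coord u - basis_coord v.
  rewrite -[RHS]basis_coord_sum; congr basis_coord.
  rewrite -{1}(basis_coordK u) -{1}(basis_coordK v) -sumrB.
  by apply: eq_bigr => i _; rewrite !ffunE mulrzBr.
by apply: eq_bigr => i _; rewrite !ffunE mulrzBr.
Qed.

HB.instance Definition _ :=
  GRing.isZmodMorphism.Build L (units B) extend_point extend_point_zmod.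

Lemma extend_point_basis i : extend_point (e i) = y i.
Proof.
pose delta := [ffun j => (j == i)%:Z].
have sum_delta (V : zmodType) (h : I -> V) : \sum_j h j *~ delta j = h i.
  rewrite (bigD1 i) //= ffunE eqxx big1 ?addr0 // => j /negbTE ji.
  by rewrite ffunE ji.
by rewrite /extend_point -{1}(sum_delta _ e) basis_coord_sum sum_delta.
Qed.

End TorusOfBasis.

Lemma char_torus_ext (K : fieldType) (L : zmodType) (B : comUnitAlgType K)
  (x y : char_torus L B) : x =1 y -> x = y.
Proof.
case: x y => [x [[[x0 xD]]]] [y [[[y0 yD]]]] /= /funext xy; case: _ / xy y0 yD.
by move=> y0 yD; rewrite (Prop_irrelevance y0 x0) (Prop_irrelevance yD xD).
Qed.

Lemma torus_iso_of_Zbasis (K : fieldType) (L : zmodType) (I : finType)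
    (e : I -> L) :
  is_Zbasis e -> torus_iso (fun B : comUnitAlgType K => @torus_eval K L I e B).
Proof.
move=> basis_e; split=> [B|B x y|B B' h x].
- exists (fun y => extend_point basis_e y : char_torus L B) => [x|y].
    apply: char_torus_ext => u /=; rewrite -[in RHS](basis_coordK basis_e u).
    rewrite raddf_sum; apply: eq_bigr => i _.
    by rewrite raddfMz ffunE.
  by apply/ffunP => i; rewrite ffunE /= extend_point_basis.
- by apply/ffunP => i; rewrite !ffunE.
- by apply/ffunP => i; rewrite !ffunE.
Qed.

(** * The basis of dihedral classes *)

Section UnitClasses.
Variables (K : fieldType) (A : comUnitAlgType K).

Fact unit_class_zmod : zmod_morphism (@unit_class K A).
Proof. by move=> u v; rewrite /unit_class raddfB. Qed.

HB.instance Definition _ := GRing.isZmodMorphism.Build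
  (units A) (char_lattice A) (@unit_class K A) unit_class_zmod.

Lemma unit_class_eq0 (u : units A) :
  unit_class u = 0 <-> exists c : K, uval u = c%:A.
Proof.
have -> : (0 : char_lattice A) = unit_class 0 by rewrite raddf0.
split=> [/eqP|[c uc]].
  by rewrite /unit_class -Quotient.idealrBE subr0 => /asboolP.
apply/eqP; rewrite /unit_class -Quotient.idealrBE subr0.
by apply/asboolP; exists c.
Qed.

Lemma uval_sum_mulrz (I : finType) (u : I -> units A) (m : I -> int) :
  uval (\sum_i u i *~ m i) = \prod_i uval (u i) ^ m i.
Proof.
have uvalMn (v : units A) k : uval (v *+ k) = uval v ^+ k.
  by elim: k => // k IH; rewrite mulrS exprS -IH.
rewrite (big_morph (@uval A) (@uvalD A) (uval0 A)); apply: eq_bigr => i _.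
case: (m i) => k; first by rewrite -pmulrn uvalMn.
by rewrite NegzE mulrNz uvalN -pmulrn uvalMn -exprnN.
Qed.

End UnitClasses.

Section DihedralBasis.
Variables (K : numFieldType) (n : nat).
Hypothesis n3 : (3 <= n)%N.

Lemma monomial_class_sum (X : {ffun diag n.+1 -> int}) :
  monomial_class K X = \sum_d dihedral_class K d *~ X d.
Proof.
rewrite /monomial_class /dihedral_class.
under eq_bigr do rewrite -raddfMz.
rewrite -raddf_sum; congr unit_class; apply: val_inj.
by rewrite /= uval_sum_mulrz.
Qed.

Lemma monomial_class_zmod : zmod_morphism (@monomial_class K n.+1).
Proof.
move=> X Y; rewrite !monomial_class_sum -sumrB; apply: eq_bigr => d _.
by rewrite !ffunE mulrzBr.
Qed.

HB.instance Definition _ := GRing.isZmodMorphism.Build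
  {ffun diag n.+1 -> int} (Lambda K n.+1) (@monomial_class K n.+1)
  monomial_class_zmod.

Lemma monomial_class_inj : injective (@monomial_class K n.+1).
Proof.
apply: raddf_inj => X /unit_class_eq0[c Xc]; exact: laurent_monomial_scalar Xc.
Qed.

Lemma monomial_class_surj (x : Lambda K n.+1) : exists X, monomial_class K X = x.
Proof.
pose u := repr x; have -> : x = unit_class u by rewrite /unit_class reprK.
have [c [X uX]] := unit_laurent_monomial n3 (uvalP u).
exists X; apply/eqP; rewrite -subr_eq0 -opprB oppr_eq0 -raddfB; apply/eqP.
apply/unit_class_eq0; exists c; rewrite uvalD uvalN uX /=.
by rewrite -scalerAl divrr ?laurent_monomial_is_unit.
Qed.

Lemma dihedral_class_basis : is_Zbasis (@dihedral_class K n.+1).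
Proof.
move=> x; have [X Xx] := monomial_class_surj x; exists X; split=> [|Y].
  by rewrite -monomial_class_sum.
by rewrite -monomial_class_sum -Xx => /monomial_class_inj.
Qed.

End DihedralBasis.

Theorem proposition1p9 (R : realType) (n : nat) (hn : (4 <= n)%N) :
  [/\ torus_iso (fun B : comUnitAlgType R[i] =>
        @torus_eval R[i] (Lambda R[i] n) (diag n)
          (@dihedral_class R[i] n) B),
      bijective (@monomial_class R[i] n),
      {morph @monomial_class R[i] n : X Y / X + Y} &
      is_Zbasis (@dihedral_class R[i] n)].
Proof.
case: n hn => // n n3; split.
- by apply: torus_iso_of_Zbasis; apply: dihedral_class_basis.
- pose coords (x : Lambda R[i] n.+1) := projT1 (cid (monomial_class_surj n3 x)).
  have coordsK : cancel coords (@monomial_class R[i] n.+1).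
    by move=> x; rewrite /coords; case: cid.
  exists coords => // X; apply: (monomial_class_inj n3); exact: coordsK.
- exact: raddfD.
- exact: dihedral_class_basis.
Qed.
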